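(* Let $S$ be a semiring. An ideal $\mathfrak{m}$ of $S$ is $z$-maximal if and only if $\mathfrak{m}$ is a $z$-ideal of $S$ that is also a maximal ideal of $S$.
   Context: A (commutative) semiring is a system $(S,+,0,\cdot,1)$ with $(S,+,0)$ and $(S,\cdot,1)$ commutative monoids, $0s=0$ for all $s\in S$, and multiplication distributing over addition. An ideal of $S$ is a nonempty subset closed under addition and under multiplication by elements of $S$; it is proper if it is not $S$. A maximal ideal is a proper ideal not properly contained in any other proper ideal. $\mathrm{Max}(S)$ is the set of maximal ideals of $S$, and for $x\in S$, $\mathcal{M}_x=\{\mathfrak{m}\in\mathrm{Max}(S)\mid x\in\mathfrak{m}\}$. An ideal $\mathfrak{z}$ of $S$ is a $z$-ideal if $\bigcap\mathcal{M}_x\subseteq\mathfrak{z}$ for every $x\in\mathfrak{z}$ (the intersection of the empty family is $S$). A proper $z$-ideal of $S$ is $z$-maximal if it is not properly contained in another proper $z$-ideal. *)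

(* Defs.v *)
From HB Require Import structures.
From mathcomp Require Import all_boot all_order all_algebra.
From mathcomp Require Import boolp classical_sets.

Set Implicit Arguments.
Unset Strict Implicit.
Unset Printing Implicit Defensive.

Import GRing.Theory.
Local Open Scope classical_set_scope.
Local Open Scope ring_scope.

(* Semirings are [comPzSemiRingType]: commutative, with 0 absorbing, and
   possibly trivial (1 = 0 is allowed). The ideals of [ring_quotient] are not
   used: they are boolean, proper by definition, and need subtraction. *)

Definition is_ideal (S : comPzSemiRingType) (I : set S) : Prop :=
  [/\ I !=set0,
      forall x y, I x -> I y -> I (x + y)
    & forall s x, I x -> I (s * x)].

Definition is_proper_ideal (S : comPzSemiRingType) (I : set S) : Prop :=
  is_ideal I /\ I <> [set: S].

Definition maximal_ideal (S : comPzSemiRingType) (m : set S) : Prop :=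
  is_proper_ideal m /\ forall J : set S, is_proper_ideal J -> ~ (m `<` J).

Definition Max (S : comPzSemiRingType) : set (set S) :=
  [set m | maximal_ideal m].

Definition Max_at (S : comPzSemiRingType) (x : S) : set (set S) :=
  [set m | @Max S m /\ m x].

(* The [\bigcap] over an empty family is the whole of [S]. *)
Definition z_ideal (S : comPzSemiRingType) (z : set S) : Prop :=
  is_ideal z /\ forall x, z x -> \bigcap_(m in Max_at x) m `<=` z.

Definition is_proper_z_ideal (S : comPzSemiRingType) (z : set S) : Prop :=
  z_ideal z /\ z <> [set: S].

Definition z_maximal (S : comPzSemiRingType) (m : set S) : Prop :=
  is_proper_z_ideal m /\ forall J : set S, is_proper_z_ideal J -> ~ (m `<` J).

(* Main.v *)
(* Zorn's lemma embeds a proper z-ideal in a maximal ideal, and every maximal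
   ideal [M] is a z-ideal, since [M] itself belongs to the family intersected
   for each [x] in [M]. *)

Require Import Defs.
From mathcomp Require Import all_boot all_order all_algebra.
From mathcomp Require Import boolp classical_sets.

Local Open Scope classical_set_scope.
Local Open Scope ring_scope.

(** A z-maximal [m] is proper, so it lies in a maximal ideal [M] ([sub_maximal_ideal]). As [M] is
    itself a proper z-ideal ([maximal_z_ideal]), z-maximality forces [m = M]. Conversely, proper
    z-ideals are proper ideals, so none can lie strictly above a maximal ideal. *)

Lemma ideal_eqT {S : comPzSemiRingType} {I : set S} :
  is_ideal I -> I = [set: S] <-> I 1.
Proof.
case=> _ _ IM; split=> [-> //|I1]; apply/seteqP; split=> // x _.
by rewrite -(GRing.mulr1 x); exact: IM.
Qed.

(** Properness survives unions of chains because, by [ideal_eqT], it means missing the single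
    element 1. *)
Lemma sub_maximal_ideal (S : comPzSemiRingType) (I : set S) :
  is_proper_ideal I -> exists2 M, maximal_ideal M & I `<=` M.
Proof.
case=> idI IneT; have [I_neq0 _ _] := idI.
(* Joining [I] to each member of the chain covers the empty chain as well. *)
pose P : set (set S) := [set X | is_proper_ideal (X `|` I)].
have [F FP Ftot|A [PA maxA]] := @Zorn_bigcup S P.
  have P0 : P set0 by rewrite /P /= set0U.
  set U := \bigcup_(X in F) X.
  (* The case [Z = set0] stands for [I] itself: elements of [I] then have a witness even when [F] is
     empty. *)
  have sUI Z : F Z \/ Z = set0 -> Z `|` I `<=` U `|` I.
    by case=> [FZ|->] x [Zx|Ix] //; [left; exists Z|right|right].
  have PF Z : F Z \/ Z = set0 -> P Z by case=> [/FP|->].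
  have mem1 x : (U `|` I) x -> exists2 Z, F Z \/ Z = set0 & (Z `|` I) x.
    by case=> [[Z FZ Zx]|Ix]; [exists Z; left|exists set0; right].
  have mem2 x y : (U `|` I) x -> (U `|` I) y ->
      exists2 Z, F Z \/ Z = set0 & (Z `|` I) x /\ (Z `|` I) y.
    move=> /mem1[X FX Xx] /mem1[Y FY Yy].
    have [XY|YX] : X `<=` Y \/ Y `<=` X.
      case: FX FY => [FX|->] [FY|->]; [exact: Ftot|right|left|left];
        exact: sub0set.
    - by exists Y => //; split => //; exact: setSU Xx.
    - by exists X => //; split => //; exact: setSU Yy.
  have idU : is_ideal (U `|` I).
    split.
    - by have [x Ix] := I_neq0; exists x; right.
    - move=> x y Ux Uy; have [Z FZ [Zx Zy]] := mem2 _ _ Ux Uy.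
      by have [[_ ZD _] _] := PF _ FZ; exact/(sUI _ FZ)/ZD.
    - move=> s x /mem1[Z FZ Zx].
      by have [[_ _ ZM] _] := PF _ FZ; exact/(sUI _ FZ)/ZM.
  split=> // /(ideal_eqT idU)/mem1[Z FZ Z1].
  by have [idZ ZneT] := PF _ FZ; exact/ZneT/(ideal_eqT idZ).
exists (A `|` I); last by move=> x; right.
(* A proper ideal [J] strictly above [A] joined with [I] absorbs [I], so it satisfies [P] and
   contradicts the maximality of [A]. *)
split=> // J pJ [AIJ JAI]; apply: (maxA J).
  by split=> [x Ax|JA]; [apply: AIJ; left|apply: JAI => x /JA; left].
suff JI : J `|` I = J by rewrite /P /= JI.
by apply/setUidPl => x Ix; apply: AIJ; right.
Qed.

Lemma maximal_z_ideal (S : comPzSemiRingType) (M : set S) :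
  maximal_ideal M -> z_ideal M.
Proof. by move=> maxM; have [[idM _] _] := maxM; split=> // x Mx y; apply. Qed.

Theorem proposition4p3 (S : comPzSemiRingType) (m : set S) (hm : is_ideal m) :
  z_maximal m <-> z_ideal m /\ maximal_ideal m.
Proof.
split=> [[[zm mneT] maxm]|[zm [[_ mneT] maxm]]].
  have [M maxM mM] := @sub_maximal_ideal S m (conj hm mneT).
  have [[_ MneT] _] := maxM.
  have zM := @maximal_z_ideal S M maxM.
  suff -> : m = M by [].
  apply/seteqP; split=> //; apply: contrapT => Mm.
  exact: (maxm M (conj zM MneT)).
by split=> // J [[idJ _] JneT]; exact: maxm.
Qed.
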